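(* Let $G=(V,W^+,W^-)$ be an instance of correlation clustering on $n$ nodes, with non-negative weights $w_{ij}^+, w_{ij}^-$ for each pair of distinct nodes $i,j$. Set $w_{ij}=|w_{ij}^+-w_{ij}^-|$, and define the $n\times n$ matrix $\mathbf{D}=(d_{ij})$ by $d_{ij}=1$ if $w_{ij}^->w_{ij}^+$ and $d_{ij}=0$ otherwise. Then $\mathbf{X}=(x_{ij})$ is an optimal solution to the correlation clustering LP relaxation $$\min_{\mathbf X}\ \sum_{i<j} w_{ij}^+x_{ij}+w_{ij}^-(1-x_{ij})\quad\text{s.t. } x_{ij}\le x_{ik}+x_{jk}\ \text{for all } i,j,k,\quad 0\le x_{ij}\le 1\ \text{for all } i,j,$$ if and only if $(\mathbf{X},\mathbf{M})$, where $\mathbf{M}=(m_{ij})=(|x_{ij}-d_{ij}|)$, is an optimal solution to the $\ell_1$ metric nearness LP $$\min_{\mathbf X,\mathbf M}\ \sum_{i<j} w_{ij}m_{ij}\quad\text{s.t. } x_{ij}\le x_{ik}+x_{jk}\ \text{for all } i,j,k,\quad x_{ij}-d_{ij}\le m_{ij},\quad d_{ij}-x_{ij}\le m_{ij}\ \text{for all } i,j.$$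
   Context: An instance of correlation clustering is a node set $V=\{1,\dots,n\}$ together with, for each unordered pair of distinct nodes $i,j$, two non-negative real weights $w_{ij}^+\in W^+$ (similarity) and $w_{ij}^-\in W^-$ (dissimilarity). All variables and data are indexed by unordered pairs of distinct nodes (so $x_{ij}=x_{ji}$, $m_{ij}=m_{ji}$, $d_{ij}=d_{ji}$, $w_{ij}=w_{ji}$; diagonal entries are zero). ''For all $i,j$'' means for all pairs of distinct nodes, and ''for all $i,j,k$'' means for all ordered triples of distinct nodes. All variables are real.
   Formalization: The equivalence is stated for X with 0 ≤ x_ij ≤ 1 on those pairs i,j where w_ij^+ = w_ij^- (so w_ij = 0); without this, a metric nearness optimum may leave [0,1] on such pairs and not be feasible for the correlation clustering LP. *)

(* Defs.v *)
From HB Require Import structures.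
From mathcomp Require Import all_boot all_order all_algebra.
From mathcomp Require Import reals.

Set Implicit Arguments.
Unset Strict Implicit.
Unset Printing Implicit Defensive.
Import Order.TTheory GRing.Theory Num.Theory.
Local Open Scope ring_scope.

(* A family of reals indexed by the unordered pairs of distinct nodes is
   encoded as a symmetric matrix with zero diagonal. *)
Definition pair_indexed (R : realType) (n : nat) (A : 'M[R]_n) : Prop :=
  A^T = A /\ forall i, A i i = 0.

Definition cc_instance (R : realType) (n : nat) (Wp Wm : 'M[R]_n) : Prop :=
  [/\ pair_indexed Wp, pair_indexed Wm &
      forall i j, i != j -> 0 <= Wp i j /\ 0 <= Wm i j].

Definition triangle_constraints (R : realType) (n : nat) (X : 'M[R]_n) : Prop :=
  forall i j k, i != j -> i != k -> j != k -> X i j <= X i k + X j k.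

Definition cc_feasible (R : realType) (n : nat) (X : 'M[R]_n) : Prop :=
  [/\ pair_indexed X, triangle_constraints X &
      forall i j, i != j -> 0 <= X i j <= 1].

Definition cc_objective (R : realType) (n : nat) (Wp Wm X : 'M[R]_n) : R :=
  \sum_(i < n) \sum_(j < n | (i < j)%N)
     (Wp i j * X i j + Wm i j * (1 - X i j)).

Definition cc_optimal (R : realType) (n : nat) (Wp Wm X : 'M[R]_n) : Prop :=
  cc_feasible X /\
  forall Y : 'M[R]_n, cc_feasible Y ->
    cc_objective Wp Wm X <= cc_objective Wp Wm Y.

Definition mn_feasible (R : realType) (n : nat) (D X M : 'M[R]_n) : Prop :=
  [/\ pair_indexed X, pair_indexed M, triangle_constraints X &
      forall i j, i != j ->
        X i j - D i j <= M i j /\ D i j - X i j <= M i j].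

Definition mn_objective (R : realType) (n : nat) (W M : 'M[R]_n) : R :=
  \sum_(i < n) \sum_(j < n | (i < j)%N) W i j * M i j.

Definition mn_optimal (R : realType) (n : nat) (W D X M : 'M[R]_n) : Prop :=
  mn_feasible D X M /\
  forall Y N : 'M[R]_n, mn_feasible D Y N ->
    mn_objective W M <= mn_objective W N.

Definition net_weight (R : realType) (n : nat) (Wp Wm : 'M[R]_n) : 'M[R]_n :=
  \matrix_(i, j) `|Wp i j - Wm i j|.

Definition target (R : realType) (n : nat) (Wp Wm : 'M[R]_n) : 'M[R]_n :=
  \matrix_(i, j) (if Wp i j < Wm i j then 1 else 0).

Definition deviation (R : realType) (n : nat) (X D : 'M[R]_n) : 'M[R]_n :=
  \matrix_(i, j) `|X i j - D i j|.

(* The metric nearness LP does not control x_ij on a pair with w_ij = 0: if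
   all weights are tied, every metric, however large, is optimal for it.  The
   box constraint must be required on such pairs; it holds vacuously when
   w_ij > 0 for all i, j. *)
Definition box_on_ties (R : realType) (n : nat) (W X : 'M[R]_n) : Prop :=
  forall i j, i != j -> W i j = 0 -> 0 <= X i j <= 1.

(* Main.v *)
Require Import Defs.
From mathcomp Require Import all_boot all_order all_algebra.
From mathcomp Require Import reals.
From mathcomp Require Import lra.
Local Open Scope ring_scope.

(** On a pair with [0 <= x <= 1], the clustering cost
    [wp * x + wm * (1 - x)] is affine in [x], with slope of absolute value
    [`|wp - wm|] and with its minimum [min wp wm] at [x = d].  It is therefore
    [`|wp - wm| * `|x - d|] plus a constant, so on the unit box the clustering
    LP and the metric nearness LP, with [m] taken as small as possible,
    minimise the same function up to an additive constant
    ([cc_objective_in_box]).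

    What separates the two LPs is that only the first imposes the box.
    Truncating every entry of a feasible matrix to [[0, 1]] keeps the triangle
    inequalities ([truncate_feasible]) and, as the targets [d] lie in
    [[0, 1]], moves no entry away from its target
    ([dist_clip_le]).  Hence an optimum over the box is an optimum over all
    metrics.  Conversely truncation strictly decreases the distance to the
    target on every pair outside the box ([clip_dist_box]), so an optimum of
    metric nearness lies in the box on every pair of positive weight
    ([mn_optimal_box]); on the remaining
    pairs, the ties, the objective is blind to [x] and the box is a hypothesis. *)

Import Order.TTheory GRing.Theory Num.Theory.

Section Truncation.
Context {R : realType}.
Implicit Types x y z d : R.

Definition clip x : R := Num.max 0 (Num.min 1 x).

Variant clip_spec x : R -> Prop :=
  | ClipNeg of x < 0 : clip_spec x 0
  | ClipBox of 0 <= x & x <= 1 : clip_spec x x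
  | ClipBig of 1 < x : clip_spec x 1.

Lemma clipP x : clip_spec x (clip x).
Proof.
rewrite /clip; case: (leP 1 x) => x1.
  rewrite max_r ?ler01 //; move: x1; rewrite le_eqVlt => /predU1P[<-|x1].
    by constructor.
  by constructor.
case: (leP 0 x) => x0; last by constructor.
by constructor => //; exact: ltW.
Qed.

Lemma clip_box x : 0 <= clip x <= 1.
Proof. by case: clipP => *; apply/andP; split; lra. Qed.

Lemma clip_triangle x y z : 0 <= y -> 0 <= z -> x <= y + z ->
  clip x <= clip y + clip z.
Proof. by move=> y0 z0 xyz; do 3!case: clipP => *; lra. Qed.

Lemma dist_clip_le x d : 0 <= d <= 1 -> `|clip x - d| <= `|x - d|.
Proof.
move=> /andP[d0 d1]; case: clipP => // [x0|x1].
- by rewrite !ler0_norm; lra.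
- by rewrite !ger0_norm; lra.
Qed.

Lemma clip_dist_box {x d} : 0 <= d <= 1 -> `|x - d| <= `|clip x - d| ->
  0 <= x <= 1.
Proof.
move=> /andP[d0 d1]; case: clipP => [x0|-> -> //|x1].
- by rewrite !ler0_norm; lra.
- by rewrite !ger0_norm; lra.
Qed.

End Truncation.

Section Programs.
Context {R : realType} {n : nat}.
Implicit Types W D X Y M N : 'M[R]_n.

Lemma pair_indexed_sym {A : 'M[R]_n} : pair_indexed A ->
  forall i j, A i j = A j i.
Proof. by move=> [AT _] i j; rewrite -{1}AT mxE. Qed.

Lemma pair_indexedP (A : 'M[R]_n) :
  (forall i j, A i j = A j i) -> (forall i, A i i = 0) -> pair_indexed A.
Proof. by move=> As A0; split=> //; apply/matrixP=> i j; rewrite mxE As. Qed.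

Lemma deviation_pair_indexed X D : pair_indexed X -> pair_indexed D ->
  pair_indexed (deviation X D).
Proof.
move=> hX hD; apply: pair_indexedP => [i j|i]; rewrite !mxE.
  by rewrite (pair_indexed_sym hX) (pair_indexed_sym hD).
by case: hX hD => _ -> [_ ->]; rewrite subrr normr0.
Qed.

Definition truncate X : 'M[R]_n := map_mx clip X.

(** Two of the three triangle inequalities on a triple add up to
    non-negativity of an entry, so on any triple of distinct nodes truncation
    acts on non-negative reals, where [clip] is the subadditive map
    [min 1].  For [n = 2] entries may be negative, but then there is no
    triangle inequality to preserve. *)
Lemma truncate_feasible {X} : pair_indexed X -> triangle_constraints X ->
  cc_feasible (truncate X).
Proof.
move=> hX tX; have Xs := pair_indexed_sym hX; split.
- apply: pair_indexedP => [i j|i]; rewrite !mxE; first by rewrite Xs.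
  by case: hX => _ ->; case: clipP => // *; lra.
- move=> i j k ij ik jk; rewrite !mxE.
  have t1 := tX _ _ _ ij ik jk.
  have := tX i k j ik ij; rewrite eq_sym jk (Xs k j) => /(_ isT) t2.
  have := tX j k i jk; rewrite eq_sym ij eq_sym ik (Xs j i) (Xs k i).
  move=> /(_ isT isT) t3.
  by apply: clip_triangle => //; lra.
- by move=> i j _; rewrite mxE clip_box.
Qed.

Lemma deviation_feasible {D X} : pair_indexed D -> pair_indexed X ->
  triangle_constraints X -> mn_feasible D X (deviation X D).
Proof.
move=> hD hX tX; split=> // [|i j _]; first exact: deviation_pair_indexed.
by rewrite mxE -normrN opprB ler_norm -normrN opprB ler_norm.
Qed.

Lemma ler_mn_objective W M N :
  (forall i j, 0 <= W i j) -> (forall i j, i != j -> M i j <= N i j) ->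
  mn_objective W M <= mn_objective W N.
Proof.
move=> W0 MN; apply: ler_sum => i _; apply: ler_sum => j ij.
by apply: ler_wpM2l => //; apply: MN; rewrite -val_eqE /= ltn_eqF.
Qed.

Lemma deviation_le_feasible {D X M} : mn_feasible D X M ->
  forall i j, i != j -> deviation X D i j <= M i j.
Proof.
move=> [_ _ _ h] i j /h[h1 h2]; rewrite mxE ler_norml; apply/andP; split; lra.
Qed.

Lemma deviation_truncate_le {D} X : (forall i j, 0 <= D i j <= 1) ->
  forall i j, deviation (truncate X) D i j <= deviation X D i j.
Proof. by move=> D01 i j; rewrite !mxE dist_clip_le. Qed.

Lemma mn_objective_eq_term {W M N} :
  (forall i j, 0 <= W i j) -> (forall i j, M i j <= N i j) ->
  mn_objective W N <= mn_objective W M ->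
  forall i j : 'I_n, (i < j)%N -> W i j * N i j = W i j * M i j.
Proof.
move=> W0 MN NM i j ij; apply/eqP; rewrite -subr_eq0; apply/eqP.
pose F (p : 'I_n * 'I_n) := W p.1 p.2 * N p.1 p.2 - W p.1 p.2 * M p.1 p.2.
have F0 p : 0 <= F p by rewrite subr_ge0 ler_wpM2l.
have sF : \sum_(p : 'I_n * 'I_n | (p.1 < p.2)%N) F p = 0.
  apply/eqP; rewrite eq_le sumr_ge0 // andbT sumrB subr_le0.
  by move: NM; rewrite /mn_objective !pair_big_dep.
have F0' (p : 'I_n * 'I_n) : (p.1 < p.2)%N -> 0 <= F p by [].
by have /(_ (i, j)) := psumr_eq0P F0' sF; apply.
Qed.

(** Truncation is a competitor that is at least as close to the target on
    every pair, so optimality forces equality on every pair of positive weight. *)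
Lemma mn_optimal_box {W D X} :
  (forall i j, 0 <= W i j) -> pair_indexed D -> (forall i j, 0 <= D i j <= 1) ->
  mn_optimal W D X (deviation X D) ->
  forall i j : 'I_n, (i < j)%N -> W i j != 0 -> 0 <= X i j <= 1.
Proof.
move=> W0 hD D01 [[hX _ tX _] opt] i j ij Wij.
have [hT tT _] := truncate_feasible hX tX.
have le := opt _ _ (deviation_feasible hD hT tT).
have /(mulfI Wij) :=
  mn_objective_eq_term W0 (deviation_truncate_le X D01) le i j ij.
by rewrite !mxE => E; apply: (clip_dist_box (D01 i j)); rewrite E.
Qed.

Section Instance.
Variables Wp Wm : 'M[R]_n.
Let W := net_weight Wp Wm.
Let D := target Wp Wm.

Lemma net_weight_ge0 i j : 0 <= W i j.
Proof. by rewrite mxE. Qed.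

Lemma target_box i j : 0 <= D i j <= 1.
Proof. by rewrite mxE; case: ifP; rewrite lexx ler01. Qed.

Lemma target_pair_indexed : pair_indexed Wp -> pair_indexed Wm ->
  pair_indexed D.
Proof.
move=> hp hm; apply: pair_indexedP => [i j|i]; rewrite !mxE.
  by rewrite (pair_indexed_sym hp) (pair_indexed_sym hm).
by case: hp hm => _ -> [_ ->]; rewrite ltxx.
Qed.

Lemma pair_cost_in_box (wp wm x : R) : 0 <= x <= 1 ->
  wp * x + wm * (1 - x) =
  `|wp - wm| * `|x - (if wp < wm then 1 else 0)| + Num.min wp wm.
Proof.
move=> /andP[x0 x1]; case: ltP => w.
- by rewrite ltr0_norm ?ler0_norm; lra.
- by rewrite ger0_norm ?ger0_norm; lra.
Qed.

Definition unavoidable_cost : R :=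
  \sum_(i < n) \sum_(j < n | (i < j)%N) Num.min (Wp i j) (Wm i j).

Lemma cc_objective_in_box {X} : (forall i j, i != j -> 0 <= X i j <= 1) ->
  cc_objective Wp Wm X = mn_objective W (deviation X D) + unavoidable_cost.
Proof.
move=> X01; rewrite /mn_objective /unavoidable_cost -big_split /=.
apply: eq_bigr => i _; rewrite -big_split /=; apply: eq_bigr => j ij.
by rewrite !mxE pair_cost_in_box // X01 // -val_eqE /= ltn_eqF.
Qed.

End Instance.
End Programs.

Theorem theorem1 (R : realType) (n : nat) (Wp Wm X : 'M[R]_n)
  (hW : cc_instance Wp Wm)
  (hX : box_on_ties (net_weight Wp Wm) X) :
  cc_optimal Wp Wm X <->
  mn_optimal (net_weight Wp Wm) (target Wp Wm)
    X (deviation X (target Wp Wm)).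
Proof.
have [hp hm _] := hW; have hD := target_pair_indexed Wp Wm hp hm.
have W0 := net_weight_ge0 Wp Wm; have D01 := target_box Wp Wm.
split=> [[[sX tX X01] opt]|optX].
- split=> [|Y N feasYN]; first exact: deviation_feasible.
  have [sY _ tY _] := feasYN.
  have feasT := truncate_feasible sY tY; have [_ _ T01] := feasT.
  have := opt _ feasT; rewrite !cc_objective_in_box // lerD2r => /le_trans; apply.
  apply: ler_mn_objective => // i j ij.
  exact: le_trans (deviation_truncate_le Y D01 i j)
                  (deviation_le_feasible feasYN i j ij).
- have [[sX _ tX _] opt] := optX.
  have X01 i j : i != j -> 0 <= X i j <= 1.
    (* Optimality speaks only of the pairs with [i < j]. *)
    wlog ij : i j / (i < j)%N.
      move=> wl ij; have := ij; rewrite -val_eqE neq_ltn => /orP[lt|lt].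
        exact: wl.
      by rewrite (pair_indexed_sym sX); apply: wl => //; rewrite eq_sym.
    move=> neq; have [Wij|Wij] := eqVneq (net_weight Wp Wm i j) 0.
      exact: hX.
    exact: (mn_optimal_box W0 hD D01 optX i j).
  split=> // Y [sY tY Y01].
  rewrite !cc_objective_in_box // lerD2r.
  exact: opt (deviation_feasible hD sY tY).
Qed.
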